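(* Let $k\geq 2$ be an integer and let $\alpha\in[1/k,1/2]$ be a constant such that the real number \[ (1-2\alpha)\log\frac{1}{1-2\alpha}-\alpha\log(\alpha^2k)-2\alpha\log\left(\frac{2}{1+\sqrt{1-1/k}}\right)+(1-2\alpha)\log(1-1/k) \] is negative. Then $\mathrm{LT}(k,n)\leq\alpha n$ for all sufficiently large $n$. In particular, $\mathrm{LT}(4,n)\leq 0.4932n$ and $\mathrm{LT}(5,n)\leq 0.48n$ for all sufficiently large $n$, and for all large $k$, \[ \mathrm{LT}(k,n)\leq\left(\frac{e}{\sqrt{k}}-\frac{e^2+1/2}{k}+O(k^{-3/2})\right)n+o(n). \]
   Context: $\log$ denotes the natural logarithm (with the convention $0\log\frac{1}{0}=0$). For a positive integer $k$ let $[k]=\{1,\dots,k\}$. A subsequence of a word $w\in[k]^n$ is a word formed by letters of $w$ at positions $i_1<\dots<i_m$. Two subsequences of $w$ are called twins if they are equal as words and no position of $w$ is used in both. $\mathrm{LT}(w)$ is the maximum length of twins in $w$, and $\mathrm{LT}(k,n)=\min_{w\in[k]^n}\mathrm{LT}(w)$. *)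

(* Defs.v *)
From mathcomp Require Import all_boot.
From Stdlib Require Import Reals.

Set Implicit Arguments.
Unset Strict Implicit.
Unset Printing Implicit Defensive.

Definition word (k n : nat) := {ffun 'I_n -> 'I_k}.

(* The subsequence of w at the positions in A, read in increasing order
   (enum of a set of ordinals is increasing). *)
Definition subseq_at k n (w : word k n) (A : {set 'I_n}) : seq 'I_k :=
  [seq w i | i <- enum A].

Definition twins k n (w : word k n) (A B : {set 'I_n}) : bool :=
  [disjoint A & B] && (subseq_at w A == subseq_at w B).

Definition LTw k n (w : word k n) : nat :=
  \max_(A : {set 'I_n} | [exists B : {set 'I_n}, twins w A B]) #|A|.

(* LT(k,n) = min over all words of length n over [k]  (for k >= 1 the
   index set is nonempty; the neutral element n is an upper bound anyway). *)
Definition LT (k n : nat) : nat := \big[minn/n]_(w : word k n) LTw w.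

Definition xlog1x (x : R) : R :=
  if Req_EM_T x 0 then 0%R else (x * ln (/ x))%R.

Open Scope R_scope.
Definition rate (k : nat) (a : R) : R :=
  xlog1x (1 - 2 * a)
  - a * ln (a ^ 2 * INR k)
  - 2 * a * ln (2 / (1 + sqrt (1 - 1 / INR k)))
  + (1 - 2 * a) * ln (1 - 1 / INR k).
Close Scope R_scope.

(* Main.v *)
(** Call two twins queue-like when the i-th letter of the first precedes the
    i-th letter of the second; every pair of twins can be relabelled so.  Reading
    the word from left to right, the first twin pushes letters on a queue and the
    second twin pops them.  If an unused letter equals the last used one, the
    latter can be exchanged for it, and if a pushed letter equals the last used
    letter and that one was a pop, the two can be exchanged.  Exhausting these
    moves gives reduced twins: every unused letter (after the first used one) and
    every push following a pop has at most k - 1 possible values.  Weighting each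
    used letter by z >= 1, the weighted number of reduced twins over all words of
    length n is governed by a 2 x 2 transfer matrix with eigenvalue
    l = (1 - 1/k) + z / sqrt k * (1 + sqrt (1 - 1/k)), whence
    z^(2 LT(k,n)) <= (n+1) l^n / sqrt (1 - 1/k).  The choice
    l = (1 - 1/k) / (1 - 2a) makes [rate k a] equal to ln l - 2 a ln z. *)

Require Import Defs.
From mathcomp Require Import all_boot all_order all_algebra zify.
From mathcomp Require ring.
From Stdlib Require Import Reals Lra.
From mathcomp Require Import Rstruct.

Set Implicit Arguments.
Unset Strict Implicit.
Unset Printing Implicit Defensive.

(** * Marked words, queues and reduced markings *)

Section Queue.
Variable L : eqType.

Notation mark := (option bool).
Notation marked := (seq (mark * L)).

Implicit Types (s u : marked) (Q : seq L) (b : bool).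

Definition letters b s : seq L := [seq x.2 | x <- s & x.1 == Some b].
Definition used s : nat := count (fun x => x.1 != None) s.

(* [Some true] marks the letters of the first twin, [Some false] those of the
   second one, [None] unused letters; [Q] holds the unmatched letters of the
   first twin. *)
Fixpoint queue_run Q s : bool :=
  match s with
  | [::] => nilp Q
  | (None, _) :: s' => queue_run Q s'
  | (Some true, c) :: s' => queue_run (rcons Q c) s'
  | (Some false, c) :: s' =>
      if Q is d :: Q' then (d == c) && queue_run Q' s' else false
  end.

(** Here [b] is the twin that lags by the letters of [Q] matched so far only by the other: its next
    letter is a pop, the other's a push. When the queue is empty and the lagging twin moves first,
    the two exchange roles, so induction needs both values of [b]. *)
Lemma queue_run_relabel b Q s :
  Q ++ letters b s = letters (~~ b) s ->
  exists s', [/\ unzip2 s' = unzip2 s, used s' = used s & queue_run Q s'].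
Proof.
elim: s b Q => [|[[x|] c] s IH] b Q; rewrite /letters /=.
- by rewrite cats0 => ->; exists [::].
- case: (altP (x =P b)) => [-> | /negPf xb].
    rewrite eqxx /= (_ : (Some b == Some (~~ b)) = false) /=; last by case: b.
    rewrite -cat_rcons => /IH [s' [e1 e2 e3]].
    by exists ((Some true, c) :: s'); rewrite /= e1 /used /= -/(used _) e2.
  have -> : x = ~~ b by case: x b xb => [] [].
  rewrite eqxx /= (_ : (Some (~~ b) == Some b) = false) /=; last by case: b {xb}.
  case: Q => [|d Q] /=.
    move=> e; have /IH [s' [e1 e2 e3]] : [:: c] ++ letters (~~ b) s = letters (~~ ~~ b) s.
      by rewrite negbK /letters e.
    by exists ((Some true, c) :: s'); rewrite /= e1 /used /= -/(used _) e2.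
  case=> -> /IH [s' [e1 e2 e3]].
  by exists ((Some false, c) :: s'); rewrite /= e1 /used /= -/(used _) e2 eqxx.
- move=> /IH [s' [e1 e2 e3]].
  by exists ((None, c) :: s'); rewrite /= e1 /used /= -/(used _) e2.
Qed.

Definition rank (x : mark) : nat := if x is Some b then if b then 1 else 2 else 0.

(* Both exchange moves decrease this potential: they shift marks of high rank to
   the right. *)
Fixpoint potential s : nat :=
  if s is x :: s' then rank x.1 * size s + potential s' else 0.

(* [p] is the last used letter with its mark; only marks of positive rank are
   constrained, so [(None, c)] with an arbitrary [c] stands for "no used letter
   yet". *)
Definition compatible (p x : mark * L) : bool :=
  (p.2 == x.2) ==> (rank p.1 <= rank x.1).

Fixpoint reduced p s : bool :=
  if s is x :: s' then
    compatible p x && reduced (if x.1 == None then p else x) s'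
  else true.

Lemma not_reduced p s : ~~ reduced p s ->
  exists s1 x u y s2, [/\ p :: s = s1 ++ x :: u ++ y :: s2,
    all (fun z => z.1 == None) u, x.2 = y.2 & rank y.1 < rank x.1].
Proof.
elim: s p => [//|x s IH] p /=.
have [cp /= | ncp _] := boolP (compatible p x); last first.
  move: ncp; rewrite /compatible negb_imply -ltnNge => /andP[/eqP e l].
  by exists [::], p, [::], x, s.
case: eqP => [xN | _] /IH [s1 [y [u [z [s2 [e uN e2 l]]]]]]; last first.
  by exists (p :: s1), y, u, z, s2; rewrite e.
case: s1 e => [|a s1] /= [-> ->].
  by exists [::], y, (x :: u), z, s2; rewrite /= xN.
by exists (a :: x :: s1), y, u, z, s2.
Qed.

Lemma queue_run_cat Q s1 s s' :
  (forall Q, queue_run Q s -> queue_run Q s') ->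
  queue_run Q (s1 ++ s) -> queue_run Q (s1 ++ s').
Proof.
move=> H; elim: s1 Q => [|[[[]|] c] s1 IH] Q /=; try exact: IH; first exact: H.
by case: Q => // d Q /andP[-> /=]; apply: IH.
Qed.

Lemma queue_run_unused Q u s : all (fun z => z.1 == None) u ->
  queue_run Q (u ++ s) = queue_run Q s.
Proof. by elim: u => [|[[b|] c] u IH] //= /IH. Qed.

Lemma queue_run_swap Q u s c (x y : mark) :
  all (fun z => z.1 == None) u -> rank y < rank x ->
  queue_run Q ((x, c) :: u ++ (y, c) :: s) ->
  queue_run Q ((y, c) :: u ++ (x, c) :: s).
Proof.
move=> uN; case: x y => [[]|] [[]|] //= _; rewrite ?queue_run_unused //=.
- case: Q => // d Q; rewrite queue_run_unused //= => /andP[/eqP -> run]; rewrite ?eqxx.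
by case: Q => // d Q; rewrite queue_run_unused.
Qed.

Lemma potential_cat s1 s s' : size s = size s' ->
  potential s' < potential s -> potential (s1 ++ s') < potential (s1 ++ s).
Proof. by move=> e l; elim: s1 => //= x s1 IH; rewrite !size_cat e ltn_add2l. Qed.

(** Each mark counts its rank once per later letter, so the drop is exactly
    [(size u).+1 * (rank x - rank y)]. *)
Lemma potential_swap u s c (x y : mark) : rank y < rank x ->
  potential ((y, c) :: u ++ (x, c) :: s) < potential ((x, c) :: u ++ (y, c) :: s).
Proof.
move=> l /=; have: potential (u ++ (x, c) :: s) + rank y * (size s).+1
    = potential (u ++ (y, c) :: s) + rank x * (size s).+1.
  elim: u => [|z u IH] /=; first by lia.
  by rewrite -!addnA IH !size_cat.
rewrite !size_cat /= addnS; set n := (size s).+1 => e.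
have n1 : rank y * (size u + n) < rank x * (size u + n) by rewrite ltn_mul2r l addn_gt0 orbT.
have : (size u).+1 * rank y < (size u).+1 * rank x by rewrite ltn_mul2l.
rewrite -(ltn_add2r (potential (u ++ (x, c) :: s) + rank y * n)) {2}e => H.
by move: H; rewrite -/n; clear -e; nia.
Qed.

Lemma reduced_relabel c s : queue_run [::] s ->
  exists s', [/\ unzip2 s' = unzip2 s, used s' = used s, queue_run [::] s'
                 & reduced (None, c) s'].
Proof.
have [n] := ubnP (potential s); elim: n s => // n IH s les run_s.
have [red | /not_reduced] := boolP (reduced (None, c) s); first by exists s.
(* The offending letter cannot be the initial pseudo-letter, whose rank is 0. *)
case=> [[|p s1]] [[x d] [u [[y d'] [s2 [/= [ep e] uN e2 l]]]]].
  by move: l; rewrite -[x]/((x, d).1) -ep.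
rewrite -{}e2 in e => {ep}.
pose s' := s1 ++ (y, d) :: u ++ (x, d) :: s2.
have [||s'' [e1 e2 run'' red'']] := IH s'.
- rewrite ltnS in les; apply: leq_trans les; rewrite e; apply: potential_cat.
    by rewrite /= !size_cat.
  exact: potential_swap.
- by move: run_s; rewrite e; apply: queue_run_cat => Q; apply: queue_run_swap.
exists s''; split=> //; first by rewrite e1 e /s' /unzip2 !(map_cat, map_cons).
rewrite e2 e /s' /used !count_cat /= !count_cat /=; clear; do !case: (_ != None); lia.
Qed.

End Queue.

(** * Weighted counting and the transfer matrix *)

Section Weight.
Import Order.TTheory GRing.Theory Num.Theory.
Local Open Scope ring_scope.
Import ring.
Variables (F : realFieldType) (L : finType) (z : F).
Hypothesis z_ge0 : 0 <= z.

Notation mark := (option bool).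
Implicit Types (Q : seq L) (p : mark * L).

(** Generating function, in [z] per used letter, of the reduced markings of [w] that empty the queue
    [Q]. A pop has maximal rank, hence is compatible with every [p]; its only guard is the head of
    the queue. *)
Fixpoint weight (w : seq L) Q p : F :=
  if w is c :: w' then
    (compatible p (None, c))%:R * weight w' Q p
    + (compatible p (Some true, c))%:R * (z * weight w' (rcons Q c) (Some true, c))
    + (if Q is d :: Q' then (d == c)%:R * (z * weight w' Q' (Some false, c)) else 0)
  else (nilp Q)%:R.

Lemma guarded_ge0 (b : bool) (x : F) : 0 <= x -> 0 <= b%:R * (z * x).
Proof. by move=> x0; rewrite mulr_ge0 ?ler0n ?mulr_ge0. Qed.

Lemma weight_ge0 w Q p : 0 <= weight w Q p.
Proof.
elim: w Q p => [|c w IH] Q p /=; first exact: ler0n.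
rewrite addr_ge0 ?addr_ge0 ?guarded_ge0 //; first by rewrite mulr_ge0 ?ler0n.
by case: Q => // d Q; rewrite guarded_ge0.
Qed.

Lemma weight_used (s : seq (mark * L)) Q p :
  queue_run Q s -> reduced p s -> z ^+ used s <= weight (unzip2 s) Q p.
Proof.
have push_ge0 (b : bool) w Q' p' : 0 <= b%:R * (z * weight w Q' p').
  by rewrite guarded_ge0 ?weight_ge0.
have pop_ge0 c w Q' :
    0 <= if Q' is d :: Q'' then (d == c)%:R * (z * weight w Q'' (Some false, c)) else 0.
  by case: Q'.
elim: s Q p => [|[[[]|] c] s IH] Q p /=; first by move=> ->.
- rewrite /used /= -/(used s) add1n exprS => run /andP[-> red].
  rewrite mul1r -addrA addrC -addrA -[leLHS]addr0 lerD ?ler_wpM2l ?IH //.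
  by rewrite addr_ge0 // mulr_ge0 ?ler0n ?weight_ge0.
- rewrite /used /= -/(used s) add1n exprS.
  case: Q => // d Q /andP[/eqP <- run] /andP[_ red].
  rewrite eqxx mul1r addrC -[leLHS]addr0 lerD ?ler_wpM2l ?IH //.
  by rewrite addr_ge0 // mulr_ge0 ?ler0n ?weight_ge0.
rewrite /used /= add0n -/(used s) => run /andP[-> red].
by rewrite mul1r -addrA -[leLHS]addr0 lerD ?IH // addr_ge0.
Qed.

Definition weight_sum n Q p : F := \sum_(w : n.-tuple L) weight w Q p.

Lemma weight_sum0 Q p : weight_sum 0 Q p = (nilp Q)%:R.
Proof.
by rewrite /weight_sum (big_pred1 [tuple]) // => t; apply/esym/eqP/val_inj; case: t => [[]].
Qed.

Lemma sum_tuple_cons n (f : seq L -> F) :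
  \sum_(w : n.+1.-tuple L) f w = \sum_c \sum_(w : n.-tuple L) f (c :: w).
Proof.
rewrite pair_big /=.
rewrite (reindex (fun x : L * n.-tuple L => [tuple of x.1 :: x.2])) //=.
exists (fun t : n.+1.-tuple L => (thead t, [tuple of behead t])) => [[c t]|t] _ /=.
  by congr pair; apply: val_inj.
by rewrite [RHS]tuple_eta; apply: val_inj.
Qed.

Lemma weight_sumS n Q p : weight_sum n.+1 Q p =
    (\sum_c (compatible p (None, c))%:R) * weight_sum n Q p
    + \sum_c (compatible p (Some true, c))%:R * (z * weight_sum n (rcons Q c) (Some true, c))
    + (if Q is d :: Q' then z * weight_sum n Q' (Some false, d) else 0).
Proof.
rewrite /weight_sum (sum_tuple_cons n (fun w => weight w Q p)) /= mulr_suml.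
under eq_bigr => c _ do rewrite !big_split /=.
rewrite !big_split /=; congr (_ + _ + _).
- by apply: eq_bigr => c _; rewrite mulr_sumr.
- by apply: eq_bigr => c _; rewrite !mulr_sumr.
case: Q => [|d Q]; first by do !rewrite big1 //.
rewrite (bigD1 d) //= eqxx [X in _ + X]big1 ?addr0.
  by rewrite mulr_sumr; apply: eq_bigr => w _; rewrite mul1r.
by move=> c /negPf; rewrite eq_sym => ->; rewrite big1 // => w _; rewrite mul0r.
Qed.

Lemma sum_neq (d : L) : \sum_(c : L) (d != c)%:R = #|L|%:R - 1 :> F.
Proof.
rewrite (eq_bigr (fun c => 1 - (c == d)%:R)); last first.
  by move=> c _; rewrite eq_sym; case: (_ == _); rewrite ?subrr ?subr0.
rewrite big_split /= sumr_const sumrN; congr (_ - _).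
by rewrite (bigD1 d) //= eqxx big1 ?addr0 // => c /negPf ->.
Qed.

(* [r] and [s] are the square roots of the alphabet size [k] and of [1 - 1/k].
   The vector [(1, s)] is the Perron eigenvector, with eigenvalue [l], of the
   transfer matrix between the states "last used letter pushed" and "last used
   letter popped"; the factor [r ^+ size Q] balances the [k] letters available
   to a push against the single letter available to a pop. *)
Variables (r s l : F).
Hypotheses (r_gt0 : 0 < r) (s_gt0 : 0 < s) (s_le1 : s <= 1).
Hypothesis r2 : r ^+ 2 = #|L|%:R.
Hypothesis s2 : r ^+ 2 * s ^+ 2 = r ^+ 2 - 1.
Hypothesis lE : l = s ^+ 2 + z / r * (1 + s).
Hypothesis l_ge1 : 1 <= l.

Definition state_factor (n : nat) (x : mark) : F :=
  match x with None => n.+1%:R | Some true => 1 | Some false => s end.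

Lemma weight_sum_le n Q p :
  weight_sum n Q p <= state_factor n p.1 * ((r ^+ 2 * l) ^+ n / (s * r ^+ size Q)).
Proof.
elim: n Q p => [|n IH] Q p.
  rewrite weight_sum0 expr0 mul1r; case: Q => [|d Q] /=; last first.
    by rewrite mulr_ge0 ?invr_ge0 ?mulr_ge0 ?exprn_ge0 ?ltW //; case: p => [[[]|] c] //=; rewrite ltW.
  rewrite expr0 mulr1 ler_pdivlMr // mul1r.
  by case: p => [[[]|] c] /=.
set X := (r ^+ 2 * l) ^+ n / (s * r ^+ size Q).
have X_ge0 : 0 <= X.
  have l0 : 0 <= l by apply: le_trans l_ge1.
  by rewrite /X mulr_ge0 ?invr_ge0 ?mulr_ge0 ?exprn_ge0 ?mulr_ge0 ?exprn_ge0 // ltW.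
have r0 : r != 0 by rewrite gt_eqF.
have s0 : s != 0 by rewrite gt_eqF.
have rn0 m : r ^+ m != 0 by rewrite expf_neq0.
(* Lengthening the queue costs a factor [r]; a pop gains [r] and moves to the state of factor
   [s]. *)
have push c : weight_sum n (rcons Q c) (Some true, c) <= X / r.
  apply: le_trans (IH _ _) _; rewrite mul1r size_rcons le_eqVlt; apply/orP; left.
  by apply/eqP; rewrite /X (exprS r (size Q)); move: (_ ^+ n) => A; field; rewrite r0 s0 rn0.
have pop : (if Q is d :: Q' then z * weight_sum n Q' (Some false, d) else 0) <= z * (s * r * X).
  case: Q @X X_ge0 {push} => [|d Q] X X_ge0.
    by apply: mulr_ge0 => //; apply: mulr_ge0 => //; apply: mulr_ge0; apply: ltW.
  rewrite ler_wpM2l //; apply: le_trans (IH _ _) _; rewrite le_eqVlt; apply/orP; left.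
  by apply/eqP; rewrite /X /= (exprS r (size Q)); move: (_ ^+ n) => A; field; rewrite r0 s0 rn0.
have pushes (b : L -> bool) : \sum_c (b c)%:R * (z * weight_sum n (rcons Q c) (Some true, c))
    <= (\sum_c (b c)%:R) * (z * (X / r)).
  rewrite mulr_suml; apply: ler_sum => c _.
  by rewrite ler_wpM2l ?ler0n // ler_wpM2l.
rewrite weight_sumS.
apply: (@le_trans _ _ ((\sum_c (compatible p (None, c))%:R) * (state_factor n p.1 * X)
   + (\sum_c (compatible p (Some true, c))%:R) * (z * (X / r)) + z * (s * r * X))).
  rewrite !lerD // ler_wpM2l ?IH // sumr_ge0 // => c _; exact: ler0n.
have -> : (r ^+ 2 * l) ^+ n.+1 / (s * r ^+ size Q) = r ^+ 2 * l * X.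
  by rewrite exprS mulrA.
have all1 : \sum_(c : L) true%:R = r ^+ 2 by rewrite sumr_const r2.
have neq d : \sum_(c : L) (d != c)%:R = r ^+ 2 * s ^+ 2 :> F by rewrite sum_neq s2 r2.
case: p => [[[]|] d] /=.
- rewrite (eq_bigr (fun c => (d != c)%:R)); last by move=> c _; rewrite /compatible /=; case: (d == c).
  rewrite [X in _ * _ + X * _ + _](eq_bigr (fun c => true%:R)); last first.
    by move=> c _; rewrite /compatible /=; case: (d == c).
  by rewrite neq all1 lE le_eqVlt; apply/orP; left; apply/eqP; field.
(* After a pop the pushes also have only [k - 1] letters: the second row. *)
- rewrite (eq_bigr (fun c => (d != c)%:R)); last by move=> c _; rewrite /compatible /=; case: (d == c).
  rewrite [X in _ * _ + X * _ + _](eq_bigr (fun c => (d != c)%:R)); last first.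
    by move=> c _; rewrite /compatible /=; case: (d == c).
  by rewrite neq lE le_eqVlt; apply/orP; left; apply/eqP; field.
rewrite (eq_bigr (fun c => true%:R)); last by move=> c _; rewrite /compatible /=; case: (d == c).
rewrite [X in _ * _ + X * _ + _](eq_bigr (fun c => true%:R)); last first.
  by move=> c _; rewrite /compatible /=; case: (d == c).
rewrite all1.
have -> : r ^+ 2 * (n.+1%:R * X) + r ^+ 2 * (z * (X / r)) + z * (s * r * X)
    = r ^+ 2 * X * (n.+1%:R + z / r * (1 + s)) by field.
have -> : n.+2%:R * (r ^+ 2 * l * X) = r ^+ 2 * X * (n.+1%:R * l + l).
  by rewrite -[in LHS]natr1; ring.
rewrite ler_wpM2l ?(mulr_ge0 (sqr_ge0 r)) // lerD ?ler_peMr ?ler0n //.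
by rewrite lE lerDr sqr_ge0.
Qed.

End Weight.

(** * From twins in words to the counting inequality *)

Lemma LT_le k n (w : word k n) : (LT k n <= LTw w)%nat.
Proof.
rewrite /LT; have: w \in index_enum (word k n : finType) by rewrite mem_index_enum.
elim: (index_enum _) => // v e IH; rewrite inE big_cons geq_min.
by case/predU1P => [-> | /IH ->]; rewrite ?leqnn ?orbT.
Qed.

Lemma LTw_twins k n (w : word k n) :
  exists A B : {set 'I_n}, twins w A B /\ #|A| = LTw w.
Proof.
pose P := [pred A : {set 'I_n} | [exists B, twins w A B]].
have P0 : set0 \in P.
  by apply/existsP; exists set0; rewrite /twins eqxx -setI_eq0 setI0 eqxx.
have [|A /existsP[B tAB] maxA] := @eq_bigmax_cond _ P (fun A => #|A|).
  by apply/card_gt0P; exists set0.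
by exists A, B; split=> //; rewrite -maxA.
Qed.

Lemma twins_cardU k n (w : word k n) (A B : {set 'I_n}) :
  twins w A B -> #|A :|: B| = #|A|.*2.
Proof.
case/andP=> dAB /eqP eAB.
have /eqP -> : #|A :|: B| == (#|A| + #|B|)%nat by rewrite leq_card_setU.
by move: (congr1 size eAB); rewrite !size_map -!cardE -addnn => ->.
Qed.

Lemma LTw_half k n (w : word k n) : ((LTw w).*2 <= n)%nat.
Proof.
have [A [B [/twins_cardU cAB <-]]] := LTw_twins w.
by rewrite -cAB -[leqRHS]card_ord max_card.
Qed.

Lemma twins_marked k n (w : n.-tuple 'I_k) (A B : {set 'I_n}) :
  twins [ffun i => tnth w i] A B ->
  exists s : seq (option bool * 'I_k),
    [/\ unzip2 s = w, used s = #|A|.*2 & letters true s = letters false s].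
Proof.
move=> tAB; case/andP: (tAB) => dAB /eqP eAB.
pose m i := if i \in A then Some true else if i \in B then Some false else None.
have enumE (D : {set 'I_n}) : enum D = filter (mem D) (enum 'I_n) by rewrite [in RHS]enumT.
have lettersE b (D : {set 'I_n}) : (forall i, (m i == Some b) = (i \in D)) ->
    letters b [seq (m i, tnth w i) | i <- enum 'I_n]
    = subseq_at [ffun i => tnth w i] D.
  move=> mD; rewrite /letters filter_map -map_comp /subseq_at.
  by rewrite enumE (eq_filter (a2 := mem D)) //; apply: eq_map => i; rewrite /= ffunE.
have mA i : (m i == Some true) = (i \in A).
  by rewrite /m; case: ifP => //; case: ifP.
have mB i : (m i == Some false) = (i \in B).
  rewrite /m; case: ifP => [iA|_]; last by case: ifP.
  by rewrite (disjointFr dAB).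
exists [seq (m i, tnth w i) | i <- enum 'I_n]; split.
- by rewrite /unzip2 -map_comp map_tnth_enum.
- rewrite /used count_map -(twins_cardU tAB) cardE enumE size_filter.
  apply: eq_count => i; rewrite /= inE /m.
  by case: ifP => //= _; case: ifP.
- by rewrite (lettersE _ A) // (lettersE _ B).
Qed.

Section Counting.

Import Order.TTheory GRing.Theory Num.Theory.
Local Open Scope ring_scope.

(** Each of the [k ^ n] words has a reduced marking with at least [2 LT] used letters, so its weight
    is at least [z ^+ (LT k n).*2] because [1 <= z]. Dividing the bound on the total weight by
    [k ^ n] leaves [l ^+ n]. *)
Lemma LT_count (F : realFieldType) k n (z r s l : F) :
  0 < r -> 0 < s -> s <= 1 -> 1 <= z -> r ^+ 2 = k%:R ->
  r ^+ 2 * s ^+ 2 = r ^+ 2 - 1 -> l = s ^+ 2 + z / r * (1 + s) -> 1 <= l ->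
  z ^+ (LT k n).*2 <= n.+1%:R * l ^+ n / s.
Proof.
move=> r0 s0 s1 z1 r2 s2 lE l1.
have k0 : (0 < k)%nat by rewrite -(ltr0n F) -r2 exprn_gt0.
have z0 : 0 <= z by apply: le_trans z1.
pose c0 : 'I_k := Ordinal k0.
have kn0 : 0 < (r ^+ 2) ^+ n by rewrite !exprn_gt0.
have lower : (r ^+ 2) ^+ n * z ^+ (LT k n).*2 <= weight_sum z n [::] (None, c0).
  rewrite r2 -natrX -{1}(card_ord k) -card_tuple mulr_natl -sumr_const.
  apply: ler_sum => w _; pose v : word k n := [ffun i => tnth w i].
  have [A [B [/twins_marked [t [tw tu tl]] cA]]] := LTw_twins v.
  have [t1 [t1w t1u t1run]] := queue_run_relabel (b := true) (Q := [::]) tl.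
  have [t2 [t2w t2u t2run t2red]] := reduced_relabel c0 t1run.
  rewrite -tw -t1w -t2w; apply: le_trans (weight_used z0 t2run t2red).
  by rewrite t2u t1u tu ler_weXn2l // leq_double cA LT_le.
have /= upper := weight_sum_le z0 r0 s0 s1 (etrans r2 _) s2 lE l1 n [::] (None, c0).
move: upper; rewrite card_ord expr0 mulr1 exprMn => /(_ erefl) upper.
have := le_trans lower upper.
by rewrite -(mulrA _ _ s^-1) mulrCA ler_pM2l // mulrA.
Qed.

End Counting.

(** * The linear bound from a negative rate *)

Open Scope R_scope.

Lemma LT_count_R k n (z r s l : R) :
  0 < r -> 0 < s -> s <= 1 -> 1 <= z -> r * r = INR k ->
  r * r * (s * s) = r * r - 1 -> l = s * s + z / r * (1 + s) -> 1 <= l ->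
  z ^ (LT k n).*2 <= INR n.+1 * l ^ n / s.
Proof.
move=> r0 s0 s1 z1 r2 s2 lE l1.
have := @LT_count R k n z r s l; rewrite !GRing.expr2 -!RmultE -!RminusE -!RplusE -!RpowE -!INRE -!RinvE.
move=> H; apply/RleP; apply: H => //; exact/RleP || exact/RltP.
Qed.

Lemma LT_le_half k n : (0 < k)%nat -> INR (LT k n) <= 1 / 2 * INR n.
Proof.
move=> k0; have := LTw_half [ffun _ : 'I_n => Ordinal k0].
move=> H; have {H}: ((LT k n).*2 <= n)%nat by apply: leq_trans H; rewrite leq_double LT_le.
rewrite -addnn => /leP /le_INR; rewrite plus_INR; lra.
Qed.

Lemma pow_exp_ln x n : 0 < x -> x ^ n = exp (INR n * ln x).
Proof. by move=> x0; rewrite -(exp_ln (x ^ n)) ?ln_pow //; apply: pow_lt. Qed.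

(** Squaring [exp (n t / 2) >= n t / 2] gives quadratic growth on the left, against at most
    [2 n / c] on the right. *)
Lemma exp_linear_bound c t n : 0 < c -> 0 < t -> (0 < n)%nat ->
  exp (INR n * t) <= INR n.+1 / c -> INR n <= 8 / (c * t ^ 2).
Proof.
move=> c0 t0 n0 H.
have n1 : 1 <= INR n by apply: (le_INR 1); apply/leP.
have nt : 0 < INR n * t / 2 by nra.
have e1 := exp_ineq1_le (INR n * t / 2).
have e2 : (INR n * t / 2) * (INR n * t / 2) <= exp (INR n * t).
  have -> : INR n * t = INR n * t / 2 + INR n * t / 2 by field.
  rewrite exp_plus; nra.
have e3 : INR n.+1 / c <= 2 * INR n / c.
  apply: Rmult_le_compat_r; first by left; apply: Rinv_0_lt_compat.
  rewrite S_INR; lra.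
have ct : 0 < c * t ^ 2 by apply: Rmult_lt_0_compat => //; apply: pow_lt.
apply: (Rmult_le_reg_r (c * t ^ 2)) => //.
rewrite /Rdiv Rmult_assoc Rinv_l; last lra.
have : (INR n * t / 2) * (INR n * t / 2) * c <= 2 * INR n.
  have -> : 2 * INR n = 2 * INR n / c * c by field; lra.
  apply: Rmult_le_compat_r; lra.
move=> e4; apply: (Rmult_le_reg_r (INR n)); nra.
Qed.

Lemma ln_div x y : 0 < x -> 0 < y -> ln (x / y) = ln x - ln y.
Proof.
move=> x0 y0; rewrite /Rdiv ln_mult ?ln_Rinv //; exact: Rinv_0_lt_compat.
Qed.

Lemma inv_INR_bounds k : (2 <= k)%nat -> 0 < 1 / INR k <= 1 / 2.
Proof.
move=> k2; have H : 2 <= INR k by apply: (le_INR 2); apply/leP.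
rewrite /Rdiv !Rmult_1_l; split; first by apply: Rinv_0_lt_compat; lra.
by apply: Rinv_le_contravar; lra.
Qed.

Lemma rate_expand k a : (2 <= k)%nat -> 0 < a < 1 / 2 ->
  rate k a = - (1 - 2 * a) * ln (1 - 2 * a) - 2 * a * ln a - a * ln (INR k)
    - 2 * a * ln 2 + 2 * a * ln (1 + sqrt (1 - 1 / INR k))
    + (1 - 2 * a) * ln (1 - 1 / INR k).
Proof.
move=> k2 a01; have kb := inv_INR_bounds k2.
have k0 : 0 < INR k by apply: (lt_INR 0); apply/leP; apply: leq_trans k2.
have s0 := sqrt_pos (1 - 1 / INR k).
rewrite /rate /xlog1x; case: Req_dec_T => [|_] /=; first lra.
rewrite ln_Rinv; last lra.
rewrite (ln_mult (a ^ 2)) //; last by apply: pow_lt; lra.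
rewrite ln_pow; last lra.
rewrite ln_div; [|lra|lra].
have -> : INR 2 = 2 by []; ring.
Qed.

Lemma LT_le_of_rate k a : (2 <= k)%nat -> 1 / INR k <= a <= 1 / 2 -> rate k a < 0 ->
  exists N : nat, forall n : nat, (N <= n)%nat -> INR (LT k n) <= a * INR n.
Proof.
(* At [a = 1/2] the eigenvalue [l] would have denominator 0; there disjointness of the twins
   suffices. *)
move=> k2 [ka [a12 | ->]] rate_neg; last first.
  by exists O => n _; apply: LT_le_half; apply: leq_trans k2.
have kb := inv_INR_bounds k2.
have k0 : 0 < INR k by apply: (lt_INR 0); apply/leP; apply: leq_trans k2.
have a0 : 0 < a by lra.
rewrite rate_expand // in rate_neg.
set q := 1 - 1 / INR k in rate_neg; have q0 : 0 < q by rewrite /q; lra.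
set s := sqrt q in rate_neg.
have s0 : 0 < s by apply: sqrt_lt_R0.
have ss : s * s = q by apply: sqrt_sqrt; lra.
have s1 : s <= 1 by rewrite -sqrt_1; apply: sqrt_le_1_alt; rewrite /q; lra.
pose r := sqrt (INR k).
have r0 : 0 < r by apply: sqrt_lt_R0.
have rr : r * r = INR k by apply: sqrt_sqrt; lra.
pose l := q / (1 - 2 * a).
have l1 : 1 <= l.
  apply: (Rmult_le_reg_r (1 - 2 * a)); first lra.
  rewrite /l /Rdiv Rmult_assoc Rinv_l /q; lra.
(* The solution of [l = s * s + z / r * (1 + s)] for the chosen [l]. *)
pose z := r * (2 * a) * q / ((1 - 2 * a) * (1 + s)).
have z0 : 0 < z.
  by apply: Rdiv_lt_0_compat; repeat apply: Rmult_lt_0_compat; lra.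
have lE : l = s * s + z / r * (1 + s).
  by rewrite ss /l /z; field; lra.
have lnl : ln l = ln q - ln (1 - 2 * a) by rewrite ln_div; lra.
have lnr : ln (INR k) = 2 * ln r by rewrite -rr ln_mult //; ring.
have lnz : ln z = ln r + ln 2 + ln a + ln q - ln (1 - 2 * a) - ln (1 + s).
  rewrite /z ln_div; try by repeat apply: Rmult_lt_0_compat; lra.
  rewrite (ln_mult (1 - 2 * a)); [|lra|lra].
  rewrite (ln_mult _ q) //; last by nra.
  rewrite (ln_mult r) //; last lra.
  rewrite (ln_mult 2) //; [ring|lra].
(* This is [- rate k a]. If [LT k n > a n], the counting inequality forces
   [exp (n t) <= (n + 1) / s], which fails for large [n]. *)
pose t := 2 * a * ln z - ln l.
have t0 : 0 < t by rewrite /t lnz lnl; move: rate_neg; rewrite lnr; lra.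
have lnl0 : 0 <= ln l.
  by rewrite -ln_1; case: l1 => [l1|<-]; [left; apply: ln_increasing; lra | right].
have lnz0 : 0 < ln z by rewrite /t in t0; nra.
have z1 : 1 <= z by left; apply: ln_lt_inv; rewrite ?ln_1 //; lra.
have [N HN] := INR_unbounded (8 / (s * t ^ 2)).
exists N.+1 => n Nn; apply: Rnot_lt_le => an.
have n0 : (0 < n)%nat by apply: leq_trans Nn.
have : INR n <= 8 / (s * t ^ 2).
  apply: exp_linear_bound => //.
  have := @LT_count_R k n z r s l r0 s0 s1 z1 rr _ lE l1.
  rewrite rr ss !pow_exp_ln //; last lra.
  have -> : INR n * t = INR n * (2 * a * ln z) + - (INR n * ln l) by rewrite /t; ring.
  rewrite exp_plus exp_Ropp => H; have {H} /H : INR k * q = INR k - 1.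
    by rewrite /q; field; lra.
  move=> H.
  have el := exp_pos (INR n * ln l).
  apply: (Rmult_le_reg_r (exp (INR n * ln l))) => //.
  rewrite Rmult_assoc Rinv_l; last lra.
  rewrite Rmult_1_r.
  have -> : INR n.+1 / s * exp (INR n * ln l) = INR n.+1 * exp (INR n * ln l) / s.
    by rewrite /Rdiv; ring.
  apply: Rle_trans H; left; apply: exp_increasing.
  rewrite -addnn plus_INR; nra.
have : INR N <= INR n by apply: le_INR; apply/leP; apply: ltnW.
lra.
Qed.

(** * Rational bounds on logarithms *)

Lemma ge0_of_derivative_ge0 (f f' : R -> R) t :
  (forall c, 0 <= c -> derivable_pt_lim f c (f' c)) ->
  (forall c, 0 <= c -> 0 <= f' c) -> f 0 = 0 -> 0 <= t -> 0 <= f t.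
Proof.
move=> df f'0 f0 [t0 | <-]; last by rewrite f0; lra.
have [|c [e [c0 _]]] := @MVT_cor2 f f' 0 t t0; first by move=> c [c0 _]; apply: df.
have := f'0 c (Rlt_le _ _ c0); rewrite f0 in e; nra.
Qed.

Lemma le_sinh t : 0 <= t -> t <= sinh t.
Proof.
move=> t0; suff : 0 <= (sinh - id)%F t by rewrite /minus_fct /id; lra.
apply: (@ge0_of_derivative_ge0 _ (fun x => cosh x - 1)) => // [c _|c _|].
- apply: derivable_pt_lim_minus; [exact: derivable_pt_lim_sinh | exact: derivable_pt_lim_id].
- have := exp_ineq1_le c; have := exp_ineq1_le (- c).
  have := exp_plus c (- c); rewrite Rplus_opp_r exp_0 /cosh.
  have := exp_pos c; have := exp_pos (- c); nra.
- by rewrite /minus_fct sinh_0 /id; ring.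
Qed.

(** Equivalent to [tanh (t / 2) <= t / 2]. The difference of the sides has derivative
    [1 + (t - 1) exp t], nonnegative by [exp (- t) >= 1 - t]. *)
Lemma exp_pade_upper t : 0 <= t -> 2 * (exp t - 1) <= t * (exp t + 1).
Proof.
move=> t0.
suff : 0 <= (id * (exp + fct_cte 1) - mult_real_fct 2 (exp - fct_cte 1))%F t.
  rewrite /minus_fct /mult_fct /plus_fct /mult_real_fct /minus_fct /fct_cte /id; lra.
apply: (@ge0_of_derivative_ge0 _ (fun x =>
  1 * ((exp + fct_cte 1)%F x) + id x * (exp x + 0) - 2 * (exp x - 0))) => // [c _|c c0|].
- apply: derivable_pt_lim_minus.
    apply: derivable_pt_lim_mult; first exact: derivable_pt_lim_id.
    apply: derivable_pt_lim_plus; [exact: derivable_pt_lim_exp|exact: derivable_pt_lim_const].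
  apply: derivable_pt_lim_scal.
  apply: derivable_pt_lim_minus; [exact: derivable_pt_lim_exp|exact: derivable_pt_lim_const].
- rewrite /plus_fct /fct_cte /id.
  have := exp_ineq1_le (- c); have := exp_plus c (- c); rewrite Rplus_opp_r exp_0.
  have := exp_pos c; have := exp_pos (- c); nra.
- by rewrite /minus_fct /mult_fct /plus_fct /mult_real_fct /minus_fct /fct_cte /id exp_0; ring.
Qed.

Lemma ln_ge0 y : 1 <= y -> 0 <= ln y.
Proof.
by move=> [y1 | <-]; rewrite -ln_1; [left; apply: ln_increasing; lra | right].
Qed.

Lemma ln_le_sinh y : 1 <= y -> ln y <= (y - / y) / 2.
Proof.
move=> y1; have := le_sinh (ln_ge0 y1).
by rewrite /sinh exp_Ropp exp_ln //; lra.
Qed.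

Lemma ln_ge_pade y : 1 <= y -> 2 * (y - 1) / (y + 1) <= ln y.
Proof.
move=> y1; have := exp_pade_upper (ln_ge0 y1); rewrite exp_ln; last lra.
move=> H; apply: (Rmult_le_reg_r (y + 1)); first lra.
rewrite /Rdiv Rmult_assoc Rinv_l; lra.
Qed.

Lemma ln_le x y : 0 < x -> x <= y -> ln x <= ln y.
Proof. by move=> x0 [xy | <-]; [left; apply: ln_increasing | right]. Qed.

(** The error of the bound on [ln y] is of third order in [y - 1], so passing to an approximate
    [n]-th root [y] of [x] sharpens it. *)
Lemma ln_le_of_le_pow x y n : 0 < x -> 1 <= y -> x <= y ^ n ->
  ln x <= INR n * ((y - / y) / 2).
Proof.
move=> x0 y1 xy; apply: (Rle_trans _ (ln (y ^ n))); first exact: ln_le.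
rewrite ln_pow; last lra.
apply: Rmult_le_compat_l; [exact: pos_INR | exact: ln_le_sinh].
Qed.

Lemma ln_ge_of_pow_le x y n : 1 <= y -> y ^ n <= x ->
  INR n * (2 * (y - 1) / (y + 1)) <= ln x.
Proof.
move=> y1 yx; apply: (Rle_trans _ (ln (y ^ n))); last first.
  by apply: ln_le => //; apply: pow_lt; lra.
rewrite ln_pow; last lra.
apply: Rmult_le_compat_l; [exact: pos_INR | exact: ln_ge_pade].
Qed.

(** This is [(1 - 2 a) ln l - 2 a ln (z / l)], which leaves only two logarithms to estimate. *)
Lemma rate_factor k a : (2 <= k)%nat -> 0 < a < 1 / 2 ->
  rate k a = (1 - 2 * a) * ln ((1 - 1 / INR k) / (1 - 2 * a))
    - 2 * a * ln (2 * a * sqrt (INR k) / (1 + sqrt (1 - 1 / INR k))).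
Proof.
move=> k2 a01; have kb := inv_INR_bounds k2.
have k0 : 0 < INR k by apply: (lt_INR 0); apply/leP; apply: leq_trans k2.
have s0 := sqrt_pos (1 - 1 / INR k); have r0 := sqrt_lt_R0 _ k0.
rewrite rate_expand // -{1}(sqrt_sqrt (INR k)); last lra.
rewrite ln_mult // !ln_div; try lra; last by nra.
rewrite ln_mult //; last lra.
rewrite ln_mult; [ring|lra|lra].
Qed.

(** * Alphabets of four and five letters *)

Lemma rate4_neg : rate 4 (4932 / 10000) < 0.
Proof.
rewrite rate_factor //; last lra.
have -> : INR 4 = 2 * 2 by rewrite /=; ring.
rewrite sqrt_square; last lra.
have sq : sqrt (1 - 1 / (2 * 2)) <= 8660255 / 10000000.
  rewrite -[X in _ <= X]sqrt_square; last lra.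
  apply: sqrt_le_1_alt; lra.
have s0 := sqrt_pos (1 - 1 / (2 * 2)).
(* [1.1055] is slightly above the 40th root of [0.75 / 0.0136]; below, [1.05721] is slightly under
   the argument of the other logarithm. *)
have up : ln ((1 - 1 / (2 * 2)) / (1 - 2 * (4932 / 10000)))
    <= INR 40 * ((11055 / 10000 - / (11055 / 10000)) / 2).
  apply: ln_le_of_le_pow; lra.
have lo : INR 1 * (2 * (105721 / 100000 - 1) / (105721 / 100000 + 1))
    <= ln (2 * (4932 / 10000) * 2 / (1 + sqrt (1 - 1 / (2 * 2)))).
  apply: ln_ge_of_pow_le; first lra.
  apply: (Rmult_le_reg_r (1 + sqrt (1 - 1 / (2 * 2)))); first lra.
  rewrite /Rdiv [X in _ <= X]Rmult_assoc Rinv_l; lra.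
have e40 : INR 40 = 40 by rewrite INR_IZR_INZ.
rewrite e40 in up; have e1 : INR 1 = 1 by [].
rewrite e1 in lo; lra.
Qed.

Lemma rate5_neg : rate 5 (48 / 100) < 0.
Proof.
rewrite rate_factor //; last lra.
have -> : INR 5 = 5 by rewrite INR_IZR_INZ.
have sq : sqrt (1 - 1 / 5) <= 8944272 / 10000000.
  rewrite -[X in _ <= X]sqrt_square; last lra.
  apply: sqrt_le_1_alt; lra.
have sq5 : 2236067 / 1000000 <= sqrt 5.
  rewrite -[X in X <= _]sqrt_square; last lra.
  apply: sqrt_le_1_alt; lra.
have s0 := sqrt_pos (1 - 1 / 5).
(* [1.04793] exceeds the 64th root of 20, and [1.06448] is just below the square root of the other
   argument. *)
have up : ln ((1 - 1 / 5) / (1 - 2 * (48 / 100)))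
    <= INR 64 * ((104793 / 100000 - / (104793 / 100000)) / 2).
  apply: ln_le_of_le_pow; lra.
have lo : INR 2 * (2 * (106448 / 100000 - 1) / (106448 / 100000 + 1))
    <= ln (2 * (48 / 100) * sqrt 5 / (1 + sqrt (1 - 1 / 5))).
  apply: ln_ge_of_pow_le; first lra.
  apply: (Rmult_le_reg_r (1 + sqrt (1 - 1 / 5))); first lra.
  rewrite /Rdiv [X in _ <= X]Rmult_assoc Rinv_l; lra.
have e64 : INR 64 = 64 by rewrite INR_IZR_INZ.
rewrite e64 in up; have e2 : INR 2 = 2 by [].
rewrite e2 in lo; lra.
Qed.

(** * Asymptotics for large alphabets *)

Lemma rate_le k a : (2 <= k)%nat -> 0 < a < 1 / 2 ->
  rate k a <= 2 * a - 2 * a ^ 2 - (1 - 2 * a) / INR k - 2 * a * ln (a * sqrt (INR k)).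
Proof.
move=> k2 a01; have kb := inv_INR_bounds k2.
have k0 : 0 < INR k by apply: (lt_INR 0); apply/leP; apply: leq_trans k2.
set b := 1 - 2 * a; have b0 : 0 < b by rewrite /b; lra.
rewrite rate_factor // -/b; set q := 1 - 1 / INR k.
have s0 := sqrt_pos q; have r0 := sqrt_lt_R0 _ k0.
have s1 : sqrt q <= 1 by rewrite -sqrt_1; apply: sqrt_le_1_alt; rewrite /q; lra.
(* Combines [ln q <= q - 1 = - 1 / k] with the sinh bound on [ln (/ b)]. The other logarithm is then
   simplified by [1 + sqrt q <= 2]. *)
have lnq : b * ln (q / b) <= - b / INR k + (1 - b ^ 2) / 2.
  have b1 : 1 <= / b by rewrite -Rinv_1; apply: Rinv_le_contravar; rewrite /b; lra.
  have q0 : 0 < q by rewrite /q; lra.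
  have := ln_le_sinh b1; rewrite Rinv_inv ln_Rinv // => lnb.
  have := exp_ineq1_le (ln q); rewrite exp_ln // {2}/q => lnq.
  have lnqb : ln (q / b) <= - (1 / INR k) + (/ b - b) / 2 by rewrite ln_div //; lra.
  have -> : - b / INR k + (1 - b ^ 2) / 2 = b * (- (1 / INR k) + (/ b - b) / 2).
    by field; lra.
  by apply: Rmult_le_compat_l; lra.
have lnr : ln (a * sqrt (INR k)) <= ln (2 * a * sqrt (INR k) / (1 + sqrt q)).
  apply: ln_le; first by nra.
  apply: (Rmult_le_reg_r (1 + sqrt q)); first lra.
  rewrite /Rdiv [X in _ <= X]Rmult_assoc Rinv_l; last lra.
  have : 0 < a * sqrt (INR k) by nra.
  nra.
have : 2 * a * ln (a * sqrt (INR k))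
    <= 2 * a * ln (2 * a * sqrt (INR k) / (1 + sqrt q)).
  by apply: Rmult_le_compat_l; lra.
move: lnq; rewrite /b /Rdiv; lra.
Qed.

Lemma rate_asymptotic_neg k d (a := exp 1 * d - (exp 1 ^ 2 + 1 / 2) * d ^ 2
    + 21 * exp 1 * d ^ 3) :
  (2 <= k)%nat -> 0 < d <= 1 / 100 -> d * sqrt (INR k) = 1 ->
  1 / INR k <= a <= 1 / 2 /\ rate k a < 0.
Proof.
move=> k2 d01 dr.
have k0 : 0 < INR k by apply: (lt_INR 0); apply/leP; apply: leq_trans k2.
have r0 := sqrt_lt_R0 _ k0; have rr := sqrt_sqrt _ (Rlt_le _ _ k0).
have kd : / INR k = d * d.
  have dk : d * d * INR k = 1.
    transitivity ((d * sqrt (INR k)) * (d * sqrt (INR k))); last by rewrite dr; ring.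
    by rewrite -{1}rr; ring.
  by apply: (Rmult_eq_reg_r (INR k)); [rewrite Rinv_l; lra | lra].
set e := exp 1 in a *.
have e3 : e <= 3 by apply: exp_le_3.
have e2 : 2 <= e by have := exp_ineq1_le 1; rewrite -/e; lra.
pose D := e ^ 2 + 1 / 2 - 21 * e * d.
have aD : a = d * (e - D * d) by rewrite /a /D; ring.
have D0 : 0 <= D by rewrite /D; nra.
have D10 : D <= 10 by rewrite /D; nra.
have Dd : 0 <= D * d <= 1 / 10 by nra.
have a0 : 0 < a by rewrite aD; nra.
have ae : a <= e * d by rewrite aD; nra.
have a1 : a < 1 / 2 by nra.
split; first by split; [rewrite /Rdiv kd Rmult_1_l aD; nra | lra].
apply: (Rle_lt_trans _ _ _ (rate_le k2 (conj a0 a1))).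
(* [ln x >= 1 - 1 / x] at [x = a / (e d)] *)
have lnr : 2 * a * ln (a * sqrt (INR k)) >= 4 * a - 2 * e * d.
  have ar0 : 0 < a * sqrt (INR k) by nra.
  have -> : ln (a * sqrt (INR k)) = 1 - ln (e / (a * sqrt (INR k))).
    rewrite ln_div //; last lra.
    by rewrite /e ln_exp; ring.
  have := exp_ineq1_le (ln (e / (a * sqrt (INR k)))); rewrite exp_ln; last first.
    by apply: Rdiv_lt_0_compat; lra.
  have -> : e / (a * sqrt (INR k)) = e * d / a.
    by rewrite -{1}[e]Rmult_1_r -dr; field; lra.
  move=> H; have : a * ln (e * d / a) <= a * (e * d / a - 1).
    by apply: Rmult_le_compat_l; lra.
  have -> : a * (e * d / a - 1) = e * d - a by field; lra.
  lra.
(* The fourth-order terms dropped from [a ^ 2] are nonnegative. *)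
have a2 : e ^ 2 * d ^ 2 - 2 * e * (e ^ 2 + 1 / 2) * d ^ 3 <= a ^ 2.
  have -> : a ^ 2 = e ^ 2 * d ^ 2 - 2 * e * D * d ^ 3 + D ^ 2 * d ^ 4.
    by rewrite aD; ring.
  have D2 : 0 <= D ^ 2 * d ^ 4.
    by apply: Rmult_le_pos; apply: pow_le; lra.
  have d3 : 0 <= e * d ^ 3 * (21 * e * d).
    by repeat apply: Rmult_le_pos; try apply: pow_le; lra.
  rewrite /D; nra.
have ad : a * d ^ 2 <= e * d ^ 3 by have := pow2_ge_0 d; nra.
have aE : a = e * d - (e ^ 2 + 1 / 2) * d ^ 2 + 21 * e * d ^ 3 by [].
have ed3 : 0 < e * d ^ 3 by apply: Rmult_lt_0_compat; [lra | apply: pow_lt; lra].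
rewrite /Rdiv kd.
have e29 : e ^ 2 <= 9 by nra.
(* In the upper bound on the rate the orders [d] and [d ^ 2] cancel, leaving this cubic term;
   [e ^ 2 <= 9] makes it negative. *)
have : e * d ^ 3 * (4 * e ^ 2 + 4 - 42) < 0 by nra.
nra.
Qed.

Theorem theorem4 :
  (forall (k : nat) (a : R),
      (2 <= k)%nat -> 1 / INR k <= a <= 1 / 2 -> rate k a < 0 ->
      exists N : nat, forall n : nat, (N <= n)%nat -> INR (LT k n) <= a * INR n)
  /\ (exists N : nat, forall n : nat, (N <= n)%nat ->
        INR (LT 4 n) <= 4932 / 10000 * INR n)
  /\ (exists N : nat, forall n : nat, (N <= n)%nat ->
        INR (LT 5 n) <= 48 / 100 * INR n)
  /\ (exists (C : R) (K0 : nat), forall k : nat, (K0 <= k)%nat ->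
        forall eps : R, 0 < eps ->
        exists N : nat, forall n : nat, (N <= n)%nat ->
          INR (LT k n) <=
            (exp 1 / sqrt (INR k) - (exp 1 ^ 2 + 1 / 2) / INR k
             + C / (INR k * sqrt (INR k))) * INR n + eps * INR n).
Proof.
split; first exact: LT_le_of_rate.
split.
  apply: LT_le_of_rate rate4_neg => //.
  have -> : INR 4 = 4 by rewrite INR_IZR_INZ.
  lra.
split.
  apply: LT_le_of_rate rate5_neg => //.
  have -> : INR 5 = 5 by rewrite INR_IZR_INZ.
  lra.
(* Beyond [10000], [d = / sqrt k] lies in the range [d <= 1 / 100] of [rate_asymptotic_neg]. *)
have [K HK] := INR_unbounded 10000.
(* Any constant above 2 e (e^2 + 1) works in place of [21 * exp 1]. *)
exists (21 * exp 1), (maxn 2 K) => k; rewrite geq_max => /andP[k2 kK] eps eps0.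
have k4 : 100 * 100 < INR k.
  by have : INR K <= INR k by [apply: le_INR; apply/leP]; lra.
have r100 : 100 < sqrt (INR k).
  by rewrite -[X in X < _](sqrt_square 100); [apply: sqrt_lt_1 | idtac]; lra.
have rr : sqrt (INR k) * sqrt (INR k) = INR k by apply: sqrt_sqrt; lra.
have [||ab rate_neg] := @rate_asymptotic_neg k (/ sqrt (INR k)) k2.
- split; first by apply: Rinv_0_lt_compat; lra.
  by rewrite /Rdiv Rmult_1_l; apply: Rinv_le_contravar; lra.
- by rewrite Rinv_l //; lra.
have [N HN] := LT_le_of_rate k2 ab rate_neg.
exists N => n /HN H; have n0 := pos_INR n.
have -> : exp 1 / sqrt (INR k) - (exp 1 ^ 2 + 1 / 2) / INR k
    + 21 * exp 1 / (INR k * sqrt (INR k))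
  = exp 1 * / sqrt (INR k) - (exp 1 ^ 2 + 1 / 2) * (/ sqrt (INR k)) ^ 2
    + 21 * exp 1 * (/ sqrt (INR k)) ^ 3.
  by move: (sqrt _) rr r100 => r <- r100; field; lra.
nra.
Qed.
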